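(* A connected temporal graph $\mathcal{G}=(G,\lambda)$, with $G=(V,E)$, admits a temporal transitive orientation if and only if it belongs to the class $\mathcal{C}_{TTO}$, i.e. if and only if there is a linear ordering $\prec$ of $V$ such that there is no triple $x\prec y\prec z$ with $xy\in E$, $yz\in E$, $\lambda(xy)\le\lambda(yz)$, and ($xz\notin E$ or $\lambda(xz)<\lambda(yz)$).
   Context: A (simple) temporal graph $\mathcal{G}=(G,\lambda)$ consists of a finite simple undirected graph $G=(V,E)$ and a function $\lambda:E\to\mathbb{N}$ (time-labels). It is connected if $G$ is connected. An orientation $O$ of $\mathcal{G}$ is the choice of exactly one of $(a,b)$, $(b,a)$ for each edge $ab\in E$. An orientation $O$ is a temporal transitive orientation (TTO) if whenever $(a,b)\in O$ and $(b,c)\in O$ with $\lambda(ab)\le\lambda(bc)$, then $(a,c)\in O$ and $\lambda(ac)\ge\lambda(bc)$. The class $\mathcal{C}_{TTO}$ is the set of connected temporal graphs admitting a linear ordering of their vertices which avoids the temporal ordered pattern ''TTO'': three ordered vertices $x\prec y\prec z$, with an edge $xy$ of label $t_1$, an edge $yz$ of label $t_2$, and between $x$ and $z$ either no edge or an edge of label $t_3$, where $t_1\le t_2$ and $t_3<t_2$. *)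

(* Defs.v *)
From mathcomp Require Import all_boot.

Set Implicit Arguments.
Unset Strict Implicit.
Unset Printing Implicit Defensive.

Record sgraph := SGraph {
  vertex :> finType;
  edge : rel vertex;
  edge_sym : symmetric edge;
  edge_irrefl : irreflexive edge
}.

Definition connected_graph (G : sgraph) : Prop :=
  forall x y : G, connect (@edge G) x y.

(* Labels are a function of the unordered pair of endpoints, so that
   lambda(ab) = lambda(ba) holds by construction.  The values of [time] on
   sets that are not edges are junk, and no definition below looks at them. *)
Record tgraph := TGraph {
  under :> sgraph;
  time : {set under} -> nat
}.

Definition label (G : tgraph) (a b : G) : nat := time [set a; b].

Definition connected (G : tgraph) : Prop := connected_graph G.

Definition orientation (G : tgraph) (O : {set G * G}) : Prop :=
  (forall a b : G, (a, b) \in O -> edge a b) /\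
  (forall a b : G, edge a b -> ((a, b) \in O) (+) ((b, a) \in O)).

Definition TTO (G : tgraph) (O : {set G * G}) : Prop :=
  orientation O /\
  forall a b c : G,
    (a, b) \in O -> (b, c) \in O -> label a b <= label b c ->
    (a, c) \in O /\ label b c <= label a c.

Definition admits_TTO (G : tgraph) : Prop := exists O : {set G * G}, TTO O.

Definition linear_ordering (T : finType) (prec : rel T) : Prop :=
  [/\ irreflexive prec, transitive prec &
      forall x y : T, x != y -> prec x y || prec y x].

Definition TTO_pattern (G : tgraph) (prec : rel G) (x y z : G) : Prop :=
  [/\ prec x y, prec y z &
   exists t1 t2 : nat,
     [/\ edge x y /\ label x y = t1,
         edge y z /\ label y z = t2,
         t1 <= t2 &
         ~~ edge x z \/
         exists t3 : nat, [/\ edge x z, label x z = t3 & t3 < t2]]].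

Definition avoids_TTO_pattern (G : tgraph) (prec : rel G) : Prop :=
  ~ exists x y z : G, TTO_pattern prec x y z.

Definition C_TTO (G : tgraph) : Prop :=
  connected G /\
  exists prec : rel G, linear_ordering prec /\ avoids_TTO_pattern prec.

(* Main.v *)
Require Import Defs.
From mathcomp Require Import all_boot.

(** Given an ordering that avoids the pattern, orient every edge forwards.
    Conversely, a temporal transitive orientation is acyclic: an arc [(b, c)] of
    maximal label among the arcs lying on directed cycles, preceded on such a
    cycle by [(a, b)], can be replaced by the shortcut [(a, c)], whose label is
    again maximal; this shortens the cycle until it becomes a loop.  Any linear
    extension of the acyclic orientation then avoids the pattern. *)

(** Vertices are sorted by their number of ancestors under [e], which grows strictly along every arc
    when there are no cycles; ties are broken by enumeration rank. *)
Lemma acyclic_linear_extension (T : finType) (e : rel T) :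
  (forall x y, e x y -> ~~ connect e y x) ->
  exists prec : rel T, linear_ordering prec /\ subrel e prec.
Proof.
move=> acyc; pose below x := [pred z | connect e z x].
(* A two-digit number in base [#|T|]: the rank is below [#|T|], so comparing keys is comparing
   lexicographically. *)
pose key x := #|below x| * #|T| + enum_rank x.
have key_lt x y : #|below x| < #|below y| -> key x < key y.
  move=> lt_xy; apply: (@leq_trans (#|below x|.+1 * #|T|)).
    by rewrite /key mulSn [ltnRHS]addnC ltn_add2l ltn_ord.
  by apply: leq_trans (leq_addr _ _); rewrite leq_mul2r lt_xy orbT.
have key_inj : injective key.
  move=> x y eq_key; case: (ltngtP #|below x| #|below y|) => [/key_lt|/key_lt|eq_b].
  - by rewrite eq_key ltnn.
  - by rewrite eq_key ltnn.
  - by apply/enum_rank_inj/val_inj/(@addnI (#|below x| * #|T|)); rewrite {2}eq_b.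
exists (fun x y => key x < key y); split.
  split=> [x|y x z|x y neq_xy]; [exact: ltnn | exact: ltn_trans |].
  by rewrite -neq_ltn (inj_eq key_inj).
(* The inclusion is strict because [y] lies below itself but, by acyclicity, not below [x]. *)
move=> x y exy; apply/key_lt/proper_card/properP; split.
  by apply/subsetP=> z; rewrite !inE => /connect_trans; apply; apply: connect1.
by exists y; rewrite !inE // acyc.
Qed.

Lemma TTO_acyclic (G : tgraph) (O : {set G * G}) :
  TTO O ->
  forall x y, (x, y) \in O -> ~~ connect (fun a b => (a, b) \in O) y x.
Proof.
set e := fun a b => (a, b) \in O.
move=> [[O_edge _] O_trans] x y xyO; apply/negP => conn_yx.
pose on_cycle (p : G * G) := (p \in O) && connect e p.2 p.1.
have xy_cyc : on_cycle (x, y) by rewrite /on_cycle xyO.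
pose lab (p : G * G) := label p.1 p.2.
case: (@arg_maxnP _ (x, y) on_cycle lab xy_cyc).
move=> [b c] /andP[/= bcO /connectP[p]] + + max_bc.
(* Induction on the return path from [c] to [b]: the shortcut keeps the head [c] and moves the tail
   back to [a], so [b] and its maximality must vary. *)
elim/last_ind: p b bcO max_bc => [|p b' IHp] b bcO max_bc /=.
  by move=> _ eq_bc; move: (O_edge _ _ bcO); rewrite eq_bc edge_irrefl.
rewrite rcons_path last_rcons => /andP[path_p e_ab'] eq_b.
rewrite -{}eq_b in e_ab'; set a := last c p in e_ab'.
have conn_ca : connect e c a by apply/connectP; exists p.
have conn_ba : connect e b a by apply: connect_trans conn_ca; apply: connect1.
have le_ab : label a b <= label b c.
  by apply: (max_bc (a, b)); rewrite /on_cycle /= conn_ba andbT.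
have [acO le_ac] := O_trans _ _ _ e_ab' bcO le_ab.
by apply: (IHp a) => // q /max_bc le_q; apply: leq_trans le_q le_ac.
Qed.

Lemma TTO_patternE (G : tgraph) (prec : rel G) (x y z : G) :
  TTO_pattern prec x y z <->
  [/\ prec x y /\ prec y z, edge x y, edge y z, label x y <= label y z &
      ~~ edge x z \/ label x z < label y z].
Proof.
split=> [[xy yz [t1 [t2 [[exy <-] [eyz <-] le_t far]]]]|].
  by split=> //; case: far => [|[t3 [_ <-]]]; [left | right].
move=> [[xy yz] exy eyz le_t far]; split=> //.
exists (label x y), (label y z); split=> //.
(* The inequality in [far] may concern the junk label of a non-edge; in that case the first
   alternative holds anyway. *)
case: (boolP (edge x z)) far => [exz [] // lt_t|]; last by left.
by right; exists (label x z).
Qed.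

Lemma admits_TTO_avoids (G : tgraph) :
  admits_TTO G <->
  exists prec : rel G, linear_ordering prec /\ avoids_TTO_pattern prec.
Proof.
split=> [[O ttoO]|[prec [[irr tr tot] avoid]]].
  have [prec [lin sub]] := acyclic_linear_extension _ _ (TTO_acyclic _ _ ttoO).
  exists prec; split=> // -[x [y [z /TTO_patternE[[xy yz] exy eyz le_t far]]]].
  have [irr tr _] := lin; have [[O_edge O_or] O_trans] := ttoO.
  (* Otherwise [O] would contain the reverse arc, which [prec] extends, against asymmetry. *)
  have forward u v : prec u v -> edge u v -> (u, v) \in O.
    move=> uv /O_or; case: ((u, v) \in O) => //= /sub vu.
    by move: (tr _ _ _ uv vu); rewrite irr.
  have [xzO le_xz] := O_trans _ _ _ (forward _ _ xy exy) (forward _ _ yz eyz) le_t.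
  by case: far; rewrite ?(O_edge _ _ xzO) // ltnNge le_xz.
exists [set p | edge p.1 p.2 && prec p.1 p.2]; split.
  split=> a b; rewrite !inE /=; first by case/andP.
  move=> eab; rewrite [edge b a]edge_sym eab /=.
  have neq_ab : a != b by apply: contraTneq eab => ->; rewrite edge_irrefl.
  have := tot _ _ neq_ab; case ab: (prec a b); case ba: (prec b a) => //.
  by move: (tr _ _ _ ab ba); rewrite irr.
move=> a b c; rewrite !inE /= => /andP[eab ab] /andP[ebc bc] le_t.
(* Transitivity already points [a] to [c], so the only possible failures are a missing edge or too
   small a label: exactly the pattern. *)
rewrite (tr _ _ _ ab bc) andbT; apply/andP/negPn/negP=> bad; apply: avoid.
exists a, b, c; apply/TTO_patternE; split=> //.
by move: bad; rewrite negb_and -ltnNge => /orP.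
Qed.

Theorem theorem5 (G : tgraph) (connG : connected G) :
  (admits_TTO G <-> C_TTO G) /\
  (admits_TTO G <->
   exists prec : rel G,
     linear_ordering prec /\
     ~ exists x y z : G,
         [/\ prec x y /\ prec y z,
             edge x y,
             edge y z,
             label x y <= label y z &
             ~~ edge x z \/ label x z < label y z]).
Proof.
split.
  by split=> [/admits_TTO_avoids | [_ /admits_TTO_avoids]].
apply: (iff_trans (admits_TTO_avoids G)).
by split=> -[prec [lin avoid]]; exists prec; split=> // -[x [y [z /TTO_patternE xyz]]];
  apply: avoid; exists x, y, z.
Qed.
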